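(* For every integer $n\ge1$, $\omega_{n+2}\le\vartheta_0\vartheta_1\cdots\vartheta_n\Omega_{n+1}$; that is, $\omega_{n+2}$ is at most the order type of the initial segment $\{\gamma\in T:\gamma<\vartheta_0\vartheta_1\cdots\vartheta_n\Omega_{n+1}\}$ of the well-order $(T,<)$.
   Context: $\omega_0:=1$ and $\omega_{k+1}:=\omega^{\omega_k}$ (so $\omega_1=\omega$). The set of formal terms $T$ and the function $S$ are defined simultaneously: $T$ is the least set such that $0\in T$, with $S(0):=-1$, and whenever $\alpha\in T$, $i\in\mathbb{N}$ and $S(\alpha)\le i+1$, then $\vartheta_i\alpha\in T$ with $S(\vartheta_i\alpha):=i$. Put $\Omega_i:=\vartheta_i0\in T$. Coefficients: $k_i(0):=0$; $k_i(\vartheta_j\beta):=\vartheta_j\beta$ if $j\le i$, and $k_i(\vartheta_j\beta):=k_i(\beta)$ if $j>i$. The ordering $<$ on $T$ (with $\le$ meaning $<$ or $=$) is defined recursively by: (1) $0<\alpha$ if $\alpha\neq0$; (2) if $i<j$, then $\vartheta_i\alpha<\vartheta_j\beta$; (3) if $\alpha<\beta$ and $k_i\alpha<\vartheta_i\beta$, then $\vartheta_i\alpha<\vartheta_i\beta$; (4) if $\alpha>\beta$ and $\vartheta_i\alpha\le k_i\beta$, then $\vartheta_i\alpha<\vartheta_i\beta$. This is a well-order on $T$. A term of $T$, when regarded as an ordinal, denotes the order type of the set of its predecessors in $(T,<)$. The set of predecessors of $\vartheta_0\vartheta_1\cdots\vartheta_n\Omega_{n+1}$ is the set $T_{n+1}[0]$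 of terms $\alpha\in T$ with $S(\alpha)\le0$ in which only symbols $\vartheta_j$ with $j<n+1$ occur. *)

(* Defs.v *)
From mathcomp Require Import all_boot all_order all_algebra.
From mathcomp Require Import zify.

Set Implicit Arguments.
Unset Strict Implicit.
Unset Printing Implicit Defensive.

Import Order.TTheory GRing.Theory Num.Theory.

(** * Ordinals *)

(** [OSup f] is the least ordinal strictly above all the [f i]; its elements,
    in the sense of von Neumann, are represented by the [f i], possibly with
    repetitions.  Equality of ordinals is [ole a b /\ ole b a]. *)
Inductive ord : Type := OSup (X : Type) (f : X -> ord).

Arguments OSup {X} f.

Fixpoint ole (a b : ord) {struct a} : Prop :=
  let: OSup X f := a in let: OSup Y g := b in
  forall i : X, exists j : Y, ole (f i) (g j).

Definition oidx (a : ord) : Type := let: OSup X _ := a in X.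

Definition oelt (a : ord) : oidx a -> ord :=
  match a with OSup _ f => f end.

(** Supremum of a family of ordinals: the union of its members. *)
Definition olub (X : Type) (F : X -> ord) : ord :=
  OSup (fun p : {i : X & oidx (F i)} => oelt (projT2 p)).

Definition ozero : ord := OSup (fun e : Empty_set => match e with end).

Definition osucc (a : ord) : ord := OSup (fun _ : unit => a).

Definition onat (n : nat) : ord := iter n osucc ozero.

Definition oomega : ord := OSup onat.

(** [a + b] is the union of [a] and [{a + c | c < b}]. *)
Fixpoint oadd (a b : ord) {struct b} : ord :=
  let: OSup Y g := b in
  OSup (fun s : oidx a + Y =>
    match s with inl i => oelt i | inr j => oadd a (g j) end).

(** [a * b] is the supremum of the [a * c + a] for [c < b]. *)
Fixpoint omul (a b : ord) {struct b} : ord :=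
  let: OSup Y g := b in olub (fun j : Y => oadd (omul a (g j)) a).

(** [omega ^ b] is the supremum of [1] and of the [omega ^ c * omega] for
    [c < b]; this covers the zero, successor and limit cases at once. *)
Fixpoint oexp_omega (b : ord) : ord :=
  let: OSup Y g := b in
  olub (fun o : option Y =>
    if o is Some j then omul (oexp_omega (g j)) oomega else onat 1).

Fixpoint omega_tower (k : nat) : ord :=
  if k is k'.+1 then oexp_omega (omega_tower k') else onat 1.

(** The order type of a well-order is the set of the order types of its proper
    initial segments. *)
Section OrderType.
Variables (A : Type) (R : A -> A -> Prop).

Fixpoint orank (x : A) (h : Acc R x) {struct h} : ord :=
  OSup (fun p : {y : A | R y x} =>
    orank (Acc_inv h (proj2_sig p))).

Definition otype (wfR : well_founded R) : ord :=
  OSup (fun x : A => orank (wfR x)).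

End OrderType.

(** * Terms *)

(** The simultaneous definition of the terms and of [S] is unfolded into raw
    terms, on which [S] makes sense without restriction, and the predicate
    [in_T] carving out the terms proper. *)
Inductive raw : Type := Zero | Theta (i : nat) (a : raw).

Definition Sraw (a : raw) : int :=
  if a is Theta i _ then i%:Z else (-1)%R.

Fixpoint in_T (a : raw) : bool :=
  if a is Theta i b then in_T b && (Sraw b <= i%:Z + 1)%R else true.

Definition T : Type := {a : raw | in_T a}.

Fixpoint kcoef (i : nat) (a : raw) : raw :=
  if a is Theta j b then (if (j <= i)%N then a else kcoef i b) else Zero.

(** The order, as the least relation closed under the four clauses; the
    recursion is well-founded and none of its calls is negated, so this is the
    recursively defined relation. *)
Inductive rlt : raw -> raw -> Prop :=
| rlt_zero i a : rlt Zero (Theta i a)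
| rlt_index i j a b : (i < j)%N -> rlt (Theta i a) (Theta j b)
| rlt_arg i a b :
    rlt a b -> rlt (kcoef i a) (Theta i b) -> rlt (Theta i a) (Theta i b)
| rlt_coef i a b :
    rlt b a -> rlt (Theta i a) (kcoef i b) \/ Theta i a = kcoef i b ->
    rlt (Theta i a) (Theta i b).

Definition tlt (a b : T) : Prop := rlt (proj1_sig a) (proj1_sig b).

(** * The order on [T] is a well-order *)

Fixpoint rsize (a : raw) : nat := if a is Theta _ b then (rsize b).+1 else 0.

Lemma kcoef_size i a : (rsize (kcoef i a) <= rsize a)%N.
Proof. by elim: a => //= j b IH; case: ifP => // _; apply: leqW. Qed.

Lemma kcoef_in_T i a : in_T a -> in_T (kcoef i a).
Proof.
by elim: a => //= j b IH /andP[Tb Sb]; case: ifP => /= [_|_]; rewrite ?Tb ?IH.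
Qed.

Lemma kcoef_kcoef i j a : (i <= j)%N -> kcoef i (kcoef j a) = kcoef i a.
Proof.
move=> ij; elim: a => //= l b IH; case: ifP => //= /negbT; rewrite -ltnNge => jl.
by rewrite IH ifN // -ltnNge (leq_ltn_trans ij).
Qed.

Lemma kcoef_id i a : (Sraw a <= i%:Z)%R -> kcoef i a = a.
Proof. by case: a => //= j b; rewrite lez_nat => ->. Qed.

Lemma Sraw_kcoef i a : (Sraw (kcoef i a) <= i%:Z)%R.
Proof. by elim: a => //= j b IH; case: ifP. Qed.

Lemma rlt_S a b : rlt a b -> (Sraw a <= Sraw b)%R.
Proof. by case=> //= *; lia. Qed.

Lemma rlt_inv i a b : rlt (Theta i a) (Theta i b) ->
  rlt a b /\ rlt (kcoef i a) (Theta i b) \/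
  rlt b a /\ (rlt (Theta i a) (kcoef i b) \/ Theta i a = kcoef i b).
Proof.
move E1 : (Theta i a) => x; move E2 : (Theta i b) => y h.
case: h E1 E2 => //.
- by move=> i' j' a' b' lt [? ?] [? ?]; subst; rewrite ltnn in lt.
- by move=> i' a' b' h1 h2 [? ?] [_ ?]; subst; left.
- by move=> i' a' b' h1 h2 [? ?] [_ ?]; subst; right.
Qed.

Lemma rlt_not0 a : ~ rlt a Zero.
Proof. by move E : Zero => z h; case: h E. Qed.

Lemma rlt_idx_le i j a b : rlt (Theta i a) (Theta j b) -> (i <= j)%N.
Proof. by move/rlt_S => /=; rewrite lez_nat. Qed.

Lemma rlt_irr a : ~ rlt a a.
Proof.
elim: a => [|i a IH]; first exact: rlt_not0.
by case/rlt_inv => [[]|[]].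
Qed.

Lemma rlt_asym a b : rlt a b -> ~ rlt b a.
Proof.
move: {2}(_ + _) (leqnn (rsize a + rsize b)) => n.
elim: n a b => [|n IH] [|i a] [|j b] /=; rewrite ?addSn //;
  try by move=> _ h1 h2; first [case: (rlt_not0 h1) | case: (rlt_not0 h2)].
move=> le lt1 lt2.
have eij : i = j by apply/eqP; rewrite eqn_leq (rlt_idx_le lt1) (rlt_idx_le lt2).
subst j; have ka := kcoef_size i a; have kb := kcoef_size i b.
case: (rlt_inv lt1) => [[ab kab]|[ba hab]]; case: (rlt_inv lt2) => [[ba' kba]|[ab' hba]].
- by apply: IH ab ba'; lia.
- case: hba => [h|e]; last by apply: (@rlt_irr (Theta i b)); rewrite {1}e.
  by apply: IH kab h => /=; lia.
- case: hab => [h|e]; last by apply: (@rlt_irr (Theta i a)); rewrite {1}e.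
  by apply: IH kba h => /=; lia.
- by apply: IH ba ab'; lia.
Qed.

Lemma rlt_total a b : rlt a b \/ a = b \/ rlt b a.
Proof.
move: {2}(_ + _) (leqnn (rsize a + rsize b)) => n.
elim: n a b => [|n IH] [|i a] [|j b] /=; rewrite ?addSn //; try by [right; left].
- by left; constructor.
- by right; right; constructor.
move=> le; case: (ltngtP i j) => [ij|ji|<-].
- by left; constructor.
- by right; right; constructor.
have ka := kcoef_size i a; have kb := kcoef_size i b.
case: (IH a b) => [|ab|[->|ba]]; [lia| |by right; left|].
- case: (IH (kcoef i a) (Theta i b)) => [/=|h|[e|h]]; first lia.
  + by left; apply: rlt_arg.
  + by right; right; apply: rlt_coef => //; right.
  + by right; right; apply: rlt_coef => //; left.
- case: (IH (kcoef i b) (Theta i a)) => [/=|h|[e|h]]; first lia.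
  + by right; right; apply: rlt_arg.
  + by left; apply: rlt_coef => //; right.
  + by left; apply: rlt_coef => //; left.
Qed.

Lemma rlt_trans a b c : rlt a b -> rlt b c -> rlt a c.
Proof.
move: {2}(_ + _) (leqnn (rsize a + rsize b + rsize c)) => n.
elim: n a b c => [|n IH] [|i a] [|j b] [|l c] /=;
  rewrite ?addSn ?ltn0 //;
  try by [constructor|
    move=> _ h1 h2; first [case: (rlt_not0 h1) | case: (rlt_not0 h2)]].
move=> le lt1 lt2.
have ij := rlt_idx_le lt1; have jl := rlt_idx_le lt2.
have [il|li] := ltnP i l; first by constructor.
have ? : i = j by lia.
have ? : i = l by lia.
subst j l => {ij jl li}.
have ka := kcoef_size i a; have kb := kcoef_size i b; have kc := kcoef_size i c.
case: (rlt_inv lt1) => [[ab kab]|[ba hab]]; case: (rlt_inv lt2) => [[bc kbc]|[cb hbc]].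
- apply: rlt_arg; first by apply: IH ab bc; lia.
  by apply: IH kab lt2 => /=; lia.
- case: (rlt_total a c) => [ac|[ac|ca]].
  + by apply: rlt_arg => //; apply: IH kab lt2 => /=; lia.
  + subst c; case: hbc => [h|e]; first by case: (rlt_asym kab h).
    by case: (@rlt_irr (Theta i b)); rewrite {1}e.
  + apply: rlt_coef => //; left; case: hbc => [h|<- //].
    by apply: IH lt1 h => /=; lia.
- case: hab => [h|-> //]; apply: IH h kbc => /=; lia.
- apply: rlt_coef; first by apply: IH cb ba; lia.
  left; case: hbc => [h|<- //].
  by apply: IH lt1 h => /=; lia.
Qed.

(** Well-foundedness, by iterated accessible parts. *)
Definition acc_part (P : raw -> Prop) (a : raw) : Prop :=
  P a /\ Acc (fun b c => P b /\ rlt b c) a.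

Fixpoint stage (i : nat) (a : raw) : Prop :=
  in_T a /\ (Sraw a <= i%:Z)%R /\
  if i is j.+1 then acc_part (stage j) (kcoef j a) else True.

Lemma acc_part_down P a b : acc_part P a -> P b -> rlt b a -> acc_part P b.
Proof. move=> [_ [acc]] Pb ba; exact: (conj Pb (acc b (conj Pb ba))). Qed.

Lemma acc_partI (P : raw -> Prop) a :
  P a -> (forall b, P b -> rlt b a -> acc_part P b) -> acc_part P a.
Proof. by move=> Pa h; apply: (conj Pa); constructor=> b [Pb /(h b Pb)[]]. Qed.

Lemma stage_in_T i a : stage i a -> in_T a.
Proof. by case: i => [|i] []. Qed.

Lemma stage_S i a : stage i a -> (Sraw a <= i%:Z)%R.
Proof. by case: i => [|i] [] _ []. Qed.

Lemma stage_down i a : stage i.+1 a -> (Sraw a <= i%:Z)%R -> acc_part (stage i) a.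
Proof. by move=> [_ [_ h]] Sa; rewrite kcoef_id in h. Qed.

Lemma acc_part_lift i a : acc_part (stage i) a -> acc_part (stage i.+1) a.
Proof.
move=> [Pa acc]; elim: acc Pa => {}a acc IH Pa.
have Sa := stage_S Pa.
apply: acc_partI => [|b Pb ba].
  split; first exact: stage_in_T Pa.
  by split; [lia|rewrite kcoef_id].
have Sb : (Sraw b <= i%:Z)%R by have := rlt_S ba; lia.
by have [Qb _] := stage_down Pb Sb; apply: IH.
Qed.

Lemma acc_part_zero i : acc_part (stage i) Zero.
Proof.
by elim: i => [|i /acc_part_lift //]; apply: acc_partI => [|b _ /rlt_not0 //].
Qed.

Lemma acc_part_Theta i a :
  acc_part (stage i.+1) a -> acc_part (stage i) (Theta i a).
Proof.
move=> [Pa acc]; elim: acc Pa => {}a acc IH Pa.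
have [Ta [Sa Ka]] := Pa.
have Pia : stage i (Theta i a).
  have TSa : in_T (Theta i a) by rewrite /= Ta /=; lia.
  case: i {acc IH Pa} Sa Ka TSa => [|i] _ [[_ [_ Ka]] _] TSa.
    by split.
  split; first exact: TSa.
  split; first exact: lexx.
  rewrite /= ltnn.
  by rewrite kcoef_kcoef in Ka.
apply: acc_partI; first exact: Pia.
move=> b.
move: {2}(rsize b) (leqnn (rsize b)) => n.
elim: n b => [|n IHn] [|j b] le Pb lt; try exact: acc_part_zero.
  exact: (False_ind _ (notF le)).
have := rlt_idx_le lt.
rewrite leq_eqVlt => /orP[/eqP ?|ji].
  subst j.
  case: (rlt_inv lt) => [[ba kba]|[_ [h|->]]]; last exact: Ka; last first.
    exact: acc_part_down Ka Pb h.
  have Tb : in_T b by case/andP: (stage_in_T Pb).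
  have Sb : (Sraw b <= i%:Z + 1)%R by case/andP: (stage_in_T Pb).
  have Kb : acc_part (stage i) (kcoef i b).
    apply: IHn; last exact: kba.
      exact: leq_trans (kcoef_size i b) le.
    case: i {acc IH Pa Sa Ka Pia kba lt ba Sb le} Pb => [|i] Pb.
      by split; [exact: kcoef_in_T|split; [exact: Sraw_kcoef|]].
    split; first exact: kcoef_in_T.
    split; first exact: Sraw_kcoef.
    by case: Pb => _ [_]; rewrite /= ltnn kcoef_kcoef.
  have Pb1 : stage i.+1 b by split; [exact: Tb|split; [lia|exact: Kb]].
  exact: (IH b (conj Pb1 ba) Pb1).
case: i {acc IH Pa Sa Ka Pia lt IHn le} ji Pb => [|i] ji Pb.
  exact: (False_ind _ (notF ji)).
apply: acc_part_lift; exact: (stage_down Pb).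
Qed.

Lemma acc_part_T i a : in_T a -> (Sraw a <= i%:Z)%R -> acc_part (stage i) a.
Proof.
elim: a i => [|j a IH] i; first by move=> *; apply: acc_part_zero.
move=> /= /andP[Ta Sa]; rewrite lez_nat => ji.
rewrite -(subnKC ji); elim: (i - j) => [|d IHd]; last first.
  by rewrite addnS; apply: acc_part_lift.
by rewrite addn0; apply/acc_part_Theta/IH => //; lia.
Qed.

Lemma tlt_wf : well_founded tlt.
Proof.
move=> a; have [i Sa] : exists i : nat, (Sraw (proj1_sig a) <= i%:Z)%R.
  by exists `|Sraw (proj1_sig a)|%N; lia.
have [_ acc] := acc_part_T (proj2_sig a) Sa.
move E : (proj1_sig a) acc Sa => x acc Sx.
elim: acc a E Sx => {}x _ IH a E Sx; constructor=> b ba.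
rewrite /tlt E in ba.
have Sb : (Sraw (proj1_sig b) <= i%:Z)%R := le_trans (rlt_S ba) Sx.
have [Pb _] := acc_part_T (proj2_sig b) Sb.
exact: (IH _ (conj Pb ba) b erefl Sb).
Qed.

Lemma tlt_trans (a b c : T) : tlt a b -> tlt b c -> tlt a c.
Proof. exact: rlt_trans. Qed.

Lemma tlt_total (a b : T) : tlt a b \/ a = b \/ tlt b a.
Proof.
case: (rlt_total (proj1_sig a) (proj1_sig b)) => [|[/val_inj ->|]]; tauto.
Qed.

(** * Terms as ordinals *)

Definition segment (t : T) : Type := {c : T | tlt c t}.

Definition segment_lt (t : T) (c d : segment t) : Prop :=
  tlt (proj1_sig c) (proj1_sig d).

Lemma segment_wf (t : T) : well_founded (@segment_lt t).
Proof.
move=> c; move E : (proj1_sig c) (tlt_wf (proj1_sig c)) => x acc.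
elim: acc c E => {}x _ IH c E; constructor=> d dc.
by apply: (IH (proj1_sig d)) => //; rewrite -E.
Qed.

Definition term_ord (t : T) : ord := otype (@segment_wf t).

(** [theta_0 theta_1 ... theta_n Omega_(n+1)] *)
Definition theta_tower_raw (n : nat) : raw :=
  foldr Theta (Theta n.+1 Zero) (iota 0 n.+1).

Lemma theta_tower_in_T (n : nat) : in_T (theta_tower_raw n).
Proof.
suff H m k : let a := foldr Theta (Theta (k + m) Zero) (iota k m) in
    in_T a /\ Sraw a = Posz k.
  by case: (H n.+1 0%N).
elim: m k => [|m IH] k /=; first by rewrite addn0; split=> //; lia.
by rewrite addnS -addSn; case: (IH k.+1) => -> ->; split=> //; lia.
Qed.

Definition theta_tower (n : nat) : T :=
  exist _ (theta_tower_raw n) (theta_tower_in_T n).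

(* Main.v *)
Require Import Defs.
From mathcomp Require Import all_boot.
From mathcomp Require Import all_order all_algebra zify.

Set Implicit Arguments.
Unset Strict Implicit.
Unset Printing Implicit Defensive.

(** Let [tower n i] be [theta_i ... theta_n Omega_(n+1)], so that the terms
    below [tower n 0] are the segment to be measured.  A word of indices acts on
    terms by applying the corresponding [Theta]s, and a word with letters [>= i]
    acts strictly monotonically on the terms [b] with [S b <= i]
    ([apply_word_mono]).  Compare two such words [s] and [t] by
    [apply_word s b < apply_word t c] for all [b], [c] with [S < i].

    If [x] is a word with letters [> i] and [S b <= i], then
    [k_i (apply_word x b) = b].  Hence the functions
    [g_x b = Theta i (apply_word x b)] are compared like the binary Veblen
    functions without fixed points: if [y] is below [x] and [u < g_x c], then
    [g_y u < g_x c] ([Theta_word_lt]).  This single fact is used in two ways.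

    - At a level [i >= 1] the words [i :: x], with [x] a word of level [i + 1],
      can be concatenated freely.  Below [l ++ i :: x] lie all the words
      [l ++ (i :: y1) ++ ... ++ (i :: yk)] with every [yj] below [x], so that
      appending [i :: x] adds at least [omega ^ rank x] to the rank
      ([rank_ge_snoc]).  The words of level [i] thus have at least [omega ^ d]
      ranks if those of level [i + 1] have [d].  The empty word gives
      [omega_0 = 1] rank at level [n + 1], so level 1 has [omega_n] ranks
      ([blocks_cofinal]).

    - At level 0 the argument of [g_x] ranges over all the terms of the segment.
      Below [g_x c] the terms are closed under [g_y] for all [y] below [x]; by
      induction [g_y] multiplies ranks by a double power of [omega].  It follows
      that [rank (g_x c) >= omega ^ omega ^ a * (1 + rank c)] if
      [rank x >= 1 + a] ([rank_ge_Theta]).  The summand 1 is there because [g_x]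
      for the least word [x] is only a successor function.  For [n >= 1] it costs
      nothing: putting the letter 1 in front of a word of level 1 raises its rank
      from [a] to [1 + a] ([rank_ge_cons]).

    The ranks in the segment are therefore closed, up to domination, under
    successor and under multiplication by [omega ^ omega ^ a] for every
    [a < omega_n], and the least ordinal with these closure properties is
    [omega ^ omega ^ omega_n] ([oexp_oexp_closed]). *)

(** * Ordinal arithmetic *)

Lemma ole_refl a : ole a a.
Proof. by elim: a => X f IH /= i; exists i. Qed.

Lemma ole_trans b a c : ole a b -> ole b c -> ole a c.
Proof.
elim: a b c => X f IH [Y g] [Z h] /= ab bc i.
have [j fg] := ab i; have [k gh] := bc j.
by exists k; apply: IH fg gh.
Qed.

(** With [oleI], the unfolding of [ole] for ordinals not in constructor form. *)
Lemma ole_oelt a b : ole a b -> forall i : oidx a, exists j : oidx b, ole (oelt i) (oelt j).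
Proof. by case: a b => [X f] [Y g]. Qed.

Lemma oleI a b : (forall i : oidx a, exists j : oidx b, ole (oelt i) (oelt j)) -> ole a b.
Proof. by case: a b => [X f] [Y g]. Qed.

Lemma oelt_le a (i : oidx a) : ole (oelt i) a.
Proof.
elim: a i => X f IH /= i.
by apply: oleI => k; exists i; apply: (IH i k).
Qed.

Lemma olub_ub X (F : X -> ord) i : ole (F i) (olub F).
Proof. by apply: oleI => k; exists (existT _ i k); apply: ole_refl. Qed.

Lemma olub_le X (F : X -> ord) b : (forall i, ole (F i) b) -> ole (olub F) b.
Proof. by move=> Fb; apply: oleI => -[i k]; apply: (ole_oelt (Fb i) k). Qed.

Lemma oadd_mono a a' b b' : ole a a' -> ole b b' -> ole (oadd a b) (oadd a' b').
Proof.
move=> aa'; elim: b b' => Y g IH [Y' g'] /= bb' [i|j].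
  by have [i' ii'] := ole_oelt aa' i; exists (inl i').
by have [j' jj'] := bb' j; exists (inr j'); apply: IH.
Qed.

Lemma oadd_zero a : ole (oadd a ozero) a.
Proof. by apply: oleI => -[i|[]]; exists i; apply: ole_refl. Qed.

Lemma zero_oadd b : ole (oadd ozero b) b.
Proof. by elim: b => Y g IH /= [[]|j]; exists j. Qed.

Lemma ole_oaddl a b : ole a (oadd a b).
Proof. by case: b => Y g; apply: oleI => i; exists (inl i); apply: ole_refl. Qed.

Lemma ole_oaddr a b : ole b (oadd a b).
Proof. by elim: b => Y g IH /= j; exists (inr j). Qed.

Lemma oadd_osucc a b : ole (oadd a (osucc b)) (osucc (oadd a b)).
Proof.
move=> [i|[]] /=; exists tt; last exact: ole_refl.
by apply: ole_trans (oelt_le i) (ole_oaddl a b).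
Qed.

Arguments oadd_osucc : clear implicits.

Lemma oaddA_le a b c : ole (oadd (oadd a b) c) (oadd a (oadd b c)).
Proof.
elim: c => Z h IH; apply: oleI => -[i|k] /=; last by exists (inr (inr k)); apply: IH.
by case: b {IH} i => Y g [i|j]; [exists (inl i)|exists (inr (inl j))]; apply: ole_refl.
Qed.

Lemma ole_oaddA a b c : ole (oadd a (oadd b c)) (oadd (oadd a b) c).
Proof.
elim: c => Z h IH; apply: oleI => -[i|[j|k]] /=; last by exists (inr k); apply: IH.
  by have [i' ?] := ole_oelt (ole_oaddl a b) i; exists (inl i').
case: b {IH} j => Y g j; exists (inl (inr j)); exact: ole_refl.
Qed.

Lemma omul_OSup a Y (g : Y -> ord) :
  omul a (OSup g) = olub (fun j => oadd (omul a (g j)) a).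
Proof. by []. Qed.

Lemma omul_mono a a' b b' : ole a a' -> ole b b' -> ole (omul a b) (omul a' b').
Proof.
move=> aa'; elim: b b' => Y g IH [Y' g'] bb'.
rewrite !omul_OSup; apply: olub_le => j; have [j' jj'] := bb' j.
apply: ole_trans (olub_ub _ j').
by apply: oadd_mono => //; apply: IH.
Qed.

Lemma omul_osucc a b : ole (oadd (omul a b) a) (omul a (osucc b)).
Proof. exact: (olub_ub (fun _ => oadd (omul a b) a) tt). Qed.

Lemma omul_osucc_le a b : ole (omul a (osucc b)) (oadd (omul a b) a).
Proof. by apply: olub_le => _; apply: ole_refl. Qed.

Lemma omul_zero a : ole (omul a ozero) ozero.
Proof. by apply: olub_le => -[]. Qed.

Arguments omul_zero : clear implicits.

Lemma one_omul b : ole (omul (onat 1) b) b.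
Proof.
elim: b => Y g IH; rewrite omul_OSup; apply: olub_le => j.
apply: ole_trans (oadd_osucc _ _) _ => -[]; exists j.
exact: ole_trans (oadd_zero _) (IH j).
Qed.

Lemma ole_omulr a b : ole (onat 1) a -> ole b (omul a b).
Proof.
move=> a1; elim: b => Y g IH; apply: oleI => j.
suff H : ole (osucc (g j)) (omul a (OSup g)) by apply: (ole_oelt H tt).
rewrite omul_OSup; apply: ole_trans (olub_ub _ j).
apply: ole_trans (oadd_mono (IH j) a1).
by move=> _; exists (inr tt); apply: (ole_oaddl (g j) ozero).
Qed.

Lemma ole_omull a b : ole (onat 1) b -> ole a (omul a b).
Proof.
move=> b1; have [j _] := ole_oelt b1 tt.
case: b b1 j => Y g _ j.
exact: ole_trans (ole_oaddr _ _) (olub_ub _ j).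
Qed.

Lemma omulDr_ge a b c : ole (oadd (omul a b) (omul a c)) (omul a (oadd b c)).
Proof.
elim: c => Z h IH; apply: oleI => -[i|[k e]].
  exact: (ole_oelt (omul_mono (ole_refl a) (ole_oaddl b (OSup h))) i).
have H : ole (oadd (omul a b) (oadd (omul a (h k)) a)) (omul a (oadd b (OSup h))).
  apply: ole_trans (ole_oaddA _ _ _) _.
  apply: ole_trans (oadd_mono (IH k) (ole_refl a)) _.
  exact: (olub_ub (fun s => oadd (omul a _) a) (inr k)).
suff /ole_oelt/(_ (inr tt)) [j ?] :
  ole (oadd (omul a b) (osucc (oelt e))) (omul a (oadd b (OSup h))) by exists j.
apply: ole_trans H; apply: oadd_mono; first exact: ole_refl.
by apply: oleI => -[]; exists e; apply: ole_refl.
Qed.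

Lemma omulA_le a b c : ole (omul (omul a b) c) (omul a (omul b c)).
Proof.
elim: c => Z h IH; rewrite omul_OSup; apply: olub_le => k.
apply: ole_trans (oadd_mono (IH k) (ole_refl _)) _.
apply: ole_trans (omulDr_ge _ _ _) _.
by apply: omul_mono (ole_refl a) _; apply: (olub_ub (fun k => oadd _ _)).
Qed.

Lemma omul_onat_addC a m : ole (oadd (omul a (onat m)) a) (oadd a (omul a (onat m))).
Proof.
elim: m => [|m IH].
  apply: ole_trans (ole_oaddl _ _).
  apply: ole_trans (oadd_mono (omul_zero a) (ole_refl a)) (zero_oadd a).
apply: ole_trans (oadd_mono (omul_osucc_le _ _) (ole_refl a)) _.
apply: ole_trans (oadd_mono IH (ole_refl a)) _.
apply: ole_trans (oaddA_le _ _ _) _.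
by apply: oadd_mono (ole_refl a) _; apply: omul_osucc.
Qed.

Lemma oexp_pos a : ole (onat 1) (oexp_omega a).
Proof. by case: a => Y g; apply: (olub_ub (fun o : option Y => _) None). Qed.

Lemma oexp_mul_omega a (j : oidx a) : ole (omul (oexp_omega (oelt j)) oomega) (oexp_omega a).
Proof. by case: a j => Y g j; apply: (olub_ub (fun o : option Y => _) (Some j)). Qed.

Lemma oexp_le a b :
  ole (onat 1) b ->
  (forall j : oidx a, ole (omul (oexp_omega (oelt j)) oomega) b) ->
  ole (oexp_omega a) b.
Proof. by case: a => Y g b1 h; apply: olub_le => -[j|]. Qed.

Lemma oexp_mono a b : ole a b -> ole (oexp_omega a) (oexp_omega b).
Proof.
elim: a b => X f IH b ab; apply: oexp_le (oexp_pos b) _ => i.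
have [j ij] := ole_oelt ab i.
apply: ole_trans (oexp_mul_omega j).
by apply: omul_mono (ole_refl _); apply: IH.
Qed.

Lemma oexp_zero : ole (oexp_omega ozero) (onat 1).
Proof. by apply: oexp_le (ole_refl _) _ => -[]. Qed.

Lemma oexp_add a b : ole (oexp_omega (oadd a b)) (omul (oexp_omega a) (oexp_omega b)).
Proof.
elim: b => Y g IH; apply: oexp_le => [|[i|j]].
- exact: ole_trans (oexp_pos a) (ole_omull _ (oexp_pos (OSup g))).
- exact: ole_trans (oexp_mul_omega i) (ole_omull _ (oexp_pos (OSup g))).
- apply: ole_trans (omul_mono (IH j) (ole_refl oomega)) _.
  apply: ole_trans (omulA_le _ _ _) _.
  by apply: omul_mono (ole_refl _) _; apply: (@oexp_mul_omega (OSup g) j).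
Qed.

(** The ordinals below [omega ^ a] are, up to domination, the multiples
    [omega ^ e * m] with [e < a] and [m] finite. *)
Lemma oexp_elt a (k : oidx (oexp_omega a)) :
  ole (oelt k) ozero \/
  exists (j : oidx a) m, ole (oelt k) (omul (oexp_omega (oelt j)) (onat m)).
Proof.
case: a k => Y g [[j|] e]; last by left; apply: ole_refl.
right; exists j; case: e => m e; exists m.+1.
exact: ole_trans (oelt_le e) (omul_osucc _ _).
Qed.

(** [omega ^ a] is the least ordinal closed under adding [omega ^ e] on the
    right, for every [e < a]. *)
Lemma oexp_closed (P : ord -> Prop) a (k : oidx (oexp_omega a)) :
  (forall c d, ole c d -> P d -> P c) -> P ozero ->
  (forall c (j : oidx a), P c -> P (oadd c (oexp_omega (oelt j)))) ->
  P (oelt k).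
Proof.
move=> Pdown P0 Padd; case: (oexp_elt k) => [/Pdown|[j [m /Pdown]]]; apply => //.
elim: m => [|m IH]; first exact: Pdown (omul_zero _) P0.
exact: Pdown (omul_osucc_le _ _) (Padd _ j IH).
Qed.

(** [omega ^ omega ^ a] is the least ordinal closed under successor and under
    multiplication on the left by [omega ^ omega ^ e], for every [e < a]: what
    lies below it is dominated by some [omega ^ (omega ^ e * l) * m], in which
    the first factor is an [l]-fold product. *)
Lemma oexp_oexp_closed (P : ord -> Prop) a (k : oidx (oexp_omega (oexp_omega a))) :
  (forall c d, ole c d -> P d -> P c) -> P ozero ->
  (forall c, P c -> P (osucc c)) ->
  (forall c (j : oidx a),
    P c -> P (omul (oexp_omega (oexp_omega (oelt j))) c)) ->
  P (oelt k).
Proof.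
move=> Pdown P0 Psucc Pmul.
have Q0 m : P (omul (oexp_omega ozero) (onat m)).
  apply: (Pdown _ _ (omul_mono oexp_zero (ole_refl _))).
  apply: (Pdown _ _ (one_omul _)).
  by elim: m => // m; apply: Psucc.
case: (oexp_elt k) => [/Pdown|[e [m /Pdown]]]; apply => //.
case: (oexp_elt e) => [e0|[j [l el]]].
  by apply: (Pdown _ _ _ (Q0 m)); apply: omul_mono (oexp_mono e0) (ole_refl _).
apply: (Pdown _ _ (omul_mono (oexp_mono el) (ole_refl _))).
(* The multiplication by omega ^ omega ^ e is on the left, so the new summand
   of the exponent has to be moved to the front of the l others. *)
elim: l m {el e k} => [|l IH] m.
  by apply: (Pdown _ _ _ (Q0 m)); apply: omul_mono (oexp_mono (omul_zero _)) (ole_refl _).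
set A := oexp_omega (oelt j) in IH *.
apply: (Pdown _ _ _ (Pmul _ j (IH m))).
apply: ole_trans (omulA_le _ _ _); apply: omul_mono (ole_refl _).
apply: ole_trans (oexp_add _ _); apply: oexp_mono.
exact: ole_trans (omul_osucc_le _ _) (omul_onat_addC _ _).
Qed.

(** * Lower bounds on ranks *)

Section RankGe.
Variables (A : Type) (R : A -> A -> Prop).

(** [a] is at most the rank of [x].  This form makes sense before [R] is known
    to be well-founded, or even transitive. *)
Fixpoint rank_ge (a : ord) (x : A) {struct a} : Prop :=
  let: OSup X f := a in forall i : X, exists y, R y x /\ rank_ge (f i) y.

Lemma rank_geE a x :
  rank_ge a x <-> forall i : oidx a, exists y, R y x /\ rank_ge (oelt i) y.
Proof. by case: a. Qed.

Lemma rank_ge_le a b x : ole a b -> rank_ge b x -> rank_ge a x.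
Proof.
elim: a b x => X f IH [Y g] x /= ab bx i.
have [j fg] := ab i; have [y [yx gy]] := bx j.
by exists y; split=> //; apply: IH fg gy.
Qed.

Lemma rank_ge_zero x : rank_ge ozero x.
Proof. by case. Qed.

Lemma rank_ge_succ a x y : R x y -> rank_ge a x -> rank_ge (osucc a) y.
Proof. by move=> xy ax _; exists x. Qed.

Lemma rank_ge_orank a x (h : Acc R x) : rank_ge a x -> ole a (orank h).
Proof.
elim: a x h => X f IH x [h] /= ax i.
have [y [yx fy]] := ax i.
by exists (exist _ y yx); apply: IH.
Qed.

End RankGe.

Lemma rank_ge_olub (A : Type) (R : A -> A -> Prop) X (F : X -> ord) x :
  (forall i, rank_ge R (F i) x) -> rank_ge R (olub F) x.
Proof. by move=> Fx [i k]; apply: ((rank_geE R (F i) x).1 (Fx i)). Qed.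

Lemma rank_ge_oadd (A : Type) (R : A -> A -> Prop) a b x :
  (forall i : oidx a, exists y, R y x /\ rank_ge R (oelt i) y) ->
  (forall k : oidx b, exists y, R y x /\ rank_ge R (oadd a (oelt k)) y) ->
  rank_ge R (oadd a b) x.
Proof. by case: b => Y g ax bx [i|k]; [apply: ax|apply: (bx k)]. Qed.

(** * Words acting on terms *)

Notation apply_word s b := (foldr Theta b s).

Lemma rlt_Theta_index i a b : (Sraw b < i%:Z)%R -> rlt b (Theta i a).
Proof. by case: b => [|j b] Sb; constructor; move: Sb => /=; lia. Qed.

(** If [k_i a = Theta i d], then [d <> a] because [d] is smaller, [a < d] is an
    instance of the fourth clause of the order, and for [d < a] the third clause
    asks for [k_i d < Theta i a].  The latter has to be reached through the
    shorter term [k_i d < Theta i d = k_i a], which is why the claim is proved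
    for all sufficiently short [u <= k_i a]. *)
Lemma kcoef_lt i a : rlt (kcoef i a) (Theta i a).
Proof.
move: {2}(rsize a) (leqnn (rsize a)) => n; elim: n i a => [|n IH] i a an.
  by case: a an => // _; constructor.
suff H m u : rsize u <= m -> rsize u <= rsize a ->
    rlt u (kcoef i a) \/ u = kcoef i a -> rlt u (Theta i a).
  by apply: (H _ _ (leqnn _) (kcoef_size i a)); right.
elim: m u => [|m IHm] [|j d] //= um ua uk; try by constructor.
have Su : (Sraw (Theta j d) <= i%:Z)%R.
  by case: uk => [/rlt_S|->]; have := Sraw_kcoef i a; lia.
have [ji|ij] := ltnP j i; first by constructor.
have ? : j = i by move: Su => /=; lia.
subst j; case: (rlt_total d a) => [da|[ea|ad]]; last exact: rlt_coef.
- apply: rlt_arg => //.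
  have kd := kcoef_size i d; apply: IHm; [lia|lia|left].
  have kdi : rlt (kcoef i d) (Theta i d) by apply: IH; lia.
  by case: uk => [/(rlt_trans kdi) //|<-].
- by move: ua; rewrite ea ltnn.
Qed.

(** [Theta k] is not monotone in general: [b < c] has to come with an inequality
    for the coefficients.  The induction therefore carries the inequality of all
    the coefficients [k_j] with [j >= i]. *)
Lemma apply_word_mono i s b c : all (leq i) s ->
  (Sraw b <= i%:Z)%R -> (Sraw c <= i%:Z)%R -> rlt b c ->
  rlt (apply_word s b) (apply_word s c).
Proof.
move=> si Sb Sc bc.
suff [] : rlt (apply_word s b) (apply_word s c) /\
  forall j, i <= j -> rlt (kcoef j (apply_word s b)) (kcoef j (apply_word s c)) by [].
elim: s si => [_|k s IH /= /andP[ik /IH[lt klt]]].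
  by split=> // j ij /=; rewrite !kcoef_id //; lia.
have ltk : rlt (Theta k (apply_word s b)) (Theta k (apply_word s c)).
  by apply: rlt_arg => //; apply: rlt_trans (klt k ik) (kcoef_lt _ _).
by split=> // j ij; case: ifP => // _; apply: klt.
Qed.

Lemma kcoef_apply_word i s b : all (leq i.+1) s -> (Sraw b <= i%:Z)%R ->
  kcoef i (apply_word s b) = b.
Proof.
move=> si Sb; elim: s si => [_|k s IH /= /andP[ik /IH ->]]; first exact: kcoef_id.
by rewrite leqNgt ik.
Qed.

Definition word_lt i s t := forall b c, (Sraw b < i%:Z)%R -> (Sraw c < i%:Z)%R ->
  rlt (apply_word s b) (apply_word t c).

(** The Veblen-style comparison of [Theta i (apply_word s u)] with
    [Theta i (apply_word t c)] for a word [s] below [t]: the third clause of the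
    order applies because the only [k_i]-coefficient on the left is [u]. *)
Lemma Theta_word_lt i s t u c : word_lt i.+1 s t -> all (leq i.+1) s ->
  (Sraw u <= i%:Z)%R -> (Sraw c <= i%:Z)%R ->
  rlt u (Theta i (apply_word t c)) ->
  rlt (Theta i (apply_word s u)) (Theta i (apply_word t c)).
Proof.
move=> st si Su Sc uc; apply: rlt_arg; first by apply: st; lia.
by rewrite kcoef_apply_word.
Qed.

Lemma lt_Theta_word i s c : all (leq i.+1) s -> (Sraw c <= i%:Z)%R ->
  rlt c (Theta i (apply_word s c)).
Proof. by move=> si Sc; rewrite -{1}(kcoef_apply_word si Sc); apply: kcoef_lt. Qed.

(** * Words as codes for ordinals *)

Definition tower n i : raw := foldr Theta (Theta n.+1 Zero) (iota i (n.+1 - i)).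

Lemma tower_Theta n i : i <= n -> tower n i = Theta i (tower n i.+1).
Proof. by move=> le; rewrite /tower subSn // subSS. Qed.

Lemma Sraw_tower n i : i <= n.+1 -> Sraw (tower n i) = Posz i.
Proof.
rewrite leq_eqVlt => /orP[/eqP->|]; first by rewrite /tower subnn.
by move=> le; rewrite tower_Theta.
Qed.

Definition below_tower n i b := in_T b /\ rlt b (tower n i).

Lemma Sraw_below n i b : i <= n.+1 -> below_tower n i b -> (Sraw b <= i%:Z)%R.
Proof. by move=> le [_ /rlt_S]; rewrite Sraw_tower. Qed.

(** The words of level [i].  The condition on the first letter bounds [S] of the
    resulting terms by [i]; closure under [below_tower] says that the word never
    leaves the terms over [theta_0, ..., theta_n]. *)
Definition block n i s :=
  [/\ all (leq i) s, head i s = i &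
    forall b, below_tower n i b -> below_tower n i (apply_word s b)].

Lemma block_cat n i s t : block n i s -> block n i t -> block n i (s ++ t).
Proof.
move=> [ss hs Ds] [ts ht Dt]; split; first by rewrite all_cat ss.
  by case: s hs {ss Ds}.
by move=> b /Dt/Ds; rewrite foldr_cat.
Qed.

(** A term below [tower n i] is below [tower n i.+1] by comparison of the
    leading indices, so [s] applies to it.  Its value is then compared with
    [tower n i = Theta i (tower n i.+1)] by the third clause of the order, the
    coefficient being the original term. *)
Lemma block_cons n i s : i <= n -> block n i.+1 s -> block n i (i :: s).
Proof.
move=> le [ss hs Ds]; split=> //= [|b Db].
  by rewrite leqnn; apply: sub_all ss => j; apply: ltnW.
have Sb : (Sraw b <= i%:Z)%R by apply: Sraw_below Db; lia.
have Db' : below_tower n i.+1 b.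
  case: Db => Tb _; split=> //.
  move: le; rewrite leq_eqVlt => /orP[/eqP en|lt].
    by rewrite /tower -en subnn; apply: rlt_Theta_index; lia.
  by rewrite tower_Theta //; apply: rlt_Theta_index; lia.
have [Tsb ltsb] := Ds _ Db'.
have := Sraw_below (_ : i.+1 <= n.+1) (conj Tsb ltsb).
split; first by rewrite /= Tsb /=; have := H le; lia.
rewrite tower_Theta //; apply: rlt_arg => //.
by rewrite kcoef_apply_word // -tower_Theta //; case: Db.
Qed.

Lemma Sraw_block n i s b : block n i s -> (Sraw b <= i%:Z)%R ->
  (Sraw (apply_word s b) <= i%:Z)%R.
Proof. by case: s => // j s [_ /= -> _]. Qed.

Definition block_lt n i s t := block n i s /\ word_lt i s t.

Lemma word_lt_trans i s t r : word_lt i s t -> word_lt i t r -> word_lt i s r.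
Proof. by move=> st tr b c Sb Sc; apply: rlt_trans (st b Zero Sb _) (tr Zero c _ Sc). Qed.

(** Appending [i :: x] adds [omega ^ rank x]: the words below [l ++ i :: x]
    include those obtained from [l] by appending any number of
    words [i :: y] with [y] below [x].  By induction each of these adds
    [omega ^ rank y], and [oexp_closed] concludes. *)
Lemma rank_ge_snoc n i a b l x : i <= n -> block n i.+1 x -> block n i l ->
  rank_ge (block_lt n i.+1) a x -> rank_ge (block_lt n i) b l ->
  rank_ge (block_lt n i) (oadd b (oexp_omega a)) (l ++ i :: x).
Proof.
move=> le; elim: a b l x => X f IH b l x Bx Bl ax bl.
have [lx _ _] := Bx; have [ll _ _] := Bl.
pose g c := apply_word (i :: x) c.
(* Letting u range over S u <= i, and not only S u < i, makes low stable under
   appending a further i :: y. *)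
pose low w := forall u c, (Sraw u <= i%:Z)%R -> (Sraw c < i%:Z)%R ->
  rlt u (g c) -> rlt (apply_word w u) (g c).
have low_lt w : low w -> word_lt i (l ++ w) (l ++ i :: x).
  move=> h u c Su Sc; rewrite !foldr_cat.
  have lt : rlt (apply_word w u) (g c).
    by apply: h => //; [lia|apply: rlt_Theta_index].
  by apply: (apply_word_mono ll _ _ lt) => //; have := rlt_S lt.
apply: rank_ge_oadd => k.
  have [s [[Bs sl] ks]] := (rank_geE _ _ _).1 bl k.
  exists s; split=> //; split=> //; apply: word_lt_trans sl _.
  by rewrite -{1}(cats0 l); apply: low_lt.
pose P c := exists w, [/\ block n i (l ++ w), low w &
  rank_ge (block_lt n i) (oadd b c) (l ++ w)].
suff [w [Bw lw rw]] : P (oelt k).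
  by exists (l ++ w); split=> //; split=> //; apply: low_lt.
apply: oexp_closed => [c d cd [w [Bw lw rw]]||c j [w [Bw lw rw]]].
- exists w; split=> //; apply: rank_ge_le rw.
  exact: oadd_mono (ole_refl b) cd.
- exists [::]; split=> //; first by rewrite cats0.
  by rewrite cats0; apply: rank_ge_le bl; apply: oadd_zero.
- have [y [[By yx] ry]] := ax j; have [ly _ _] := By.
  exists (w ++ i :: y); rewrite catA; split.
  + by apply: block_cat => //; apply: block_cons.
  + move=> u c' Su Sc ug; rewrite foldr_cat; apply: lw => //=.
    by apply: Theta_word_lt => //; lia.
  + by apply: rank_ge_le (IH j _ _ _ By Bw ry rw); apply: ole_oaddA.
Qed.

Lemma blocks_cofinal n d i : i + d = n.+1 -> forall k : oidx (omega_tower d),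
  exists s, block n i s /\ rank_ge (block_lt n i) (oelt k) s.
Proof.
elim: d i => [|d IH] i id k; first by exists [::]; split=> //; case: k.
pose P c := exists s, block n i s /\ rank_ge (block_lt n i) c s.
apply: (@oexp_closed P _ k) => [c e ce [s [Bs es]]||c j [s [Bs cs]]].
- by exists s; split=> //; apply: rank_ge_le ce es.
- by exists [::]; split=> //; apply: rank_ge_zero.
- have [|x [Bx jx]] := IH i.+1 _ j; first by lia.
  have le : i <= n by lia.
  exists (s ++ i :: x); split; last exact: rank_ge_snoc.
  by apply: block_cat => //; apply: block_cons.
Qed.

(** The empty word is below [i :: s], and [t |-> i :: t] is strictly monotone.
    This absorbs the 1 of [rank_ge_Theta]. *)
Lemma rank_ge_cons n i a s : i <= n -> block n i s ->
  rank_ge (block_lt n i) a s -> rank_ge (block_lt n i) (oadd (onat 1) a) (i :: s).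
Proof.
move=> le; elim: a s => X f IH s Bs rs.
have Bi t : block n i t -> block n i (i :: t).
  by apply: (@block_cat _ _ [:: i]); apply: block_cons.
move=> [[]|j] /=.
  exists [::]; split; last exact: rank_ge_zero.
  by split=> // b c Sb _; apply: rlt_Theta_index.
have [t [[Bt ts] rt]] := rs j.
exists (i :: t); split; last exact: IH.
split=> [|b c Sb Sc]; first exact: Bi.
apply: (@apply_word_mono i [:: i]); rewrite /= ?leqnn //; last exact: ts.
  by apply: Sraw_block Bt _; lia.
by apply: Sraw_block Bs _; lia.
Qed.

(** * The terms of level 0 *)

Definition tower_lt n u v := below_tower n 0 u /\ rlt u v.

Lemma rank_ge_trans n a u v : rank_ge (tower_lt n) a u -> rlt u v ->
  rank_ge (tower_lt n) a v.
Proof.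
case: a => X f ru uv i; have [y [[Dy yu] ry]] := ru i.
by exists y; split=> //; split=> //; apply: rlt_trans uv.
Qed.

(** Induction on [a], then on [b].  Let [v] be the term in question and
    [E = omega ^ omega ^ a].  It suffices that a term [u < v] of rank [>= d]
    forces [v] to have rank [>= d + E]: use it with [u = c] and [d = 0], and with
    [u = Theta 0 (apply_word x c')] and [d = E * (1 + b')], where [c' < c] has
    rank [>= b'].  For [y] below [x], the terms below [v] are closed under
    [w |-> Theta 0 (apply_word y w)].  That function raises ranks by at least 1,
    and by the induction hypothesis it takes a rank [d + e] to at least
    [omega ^ omega ^ a' * (d + e) >= d + omega ^ omega ^ a' * e] for some given
    [a' < a].  By [oexp_oexp_closed], the [e] for which [d + e] is reached below
    [v] include everything below [E]. *)
Lemma rank_ge_Theta n a x b c : block n 1 x ->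
  rank_ge (block_lt n 1) (oadd (onat 1) a) x ->
  below_tower n 0 c -> rank_ge (tower_lt n) b c ->
  rank_ge (tower_lt n) (omul (oexp_omega (oexp_omega a)) (oadd (onat 1) b))
    (Theta 0 (apply_word x c)).
Proof.
elim: a x b c => X f IHa x b; elim: b => Y g IHb c Bx rx Dc rc.
have D0 y u : block n 1 y -> below_tower n 0 u ->
    below_tower n 0 (Theta 0 (apply_word y u)).
  by move=> By; have [_ _] := block_cons (leq0n n) By; apply.
have S0 u : below_tower n 0 u -> (Sraw u <= 0)%R by apply: Sraw_below.
have [lx _ _] := Bx.
set v := Theta 0 _; set E := oexp_omega (oexp_omega _).
suff add_E d u : below_tower n 0 u -> rlt u v -> rank_ge (tower_lt n) d u ->
    rank_ge (tower_lt n) (oadd d E) v.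
  rewrite omul_OSup; apply: rank_ge_olub => -[[]|j].
    apply: (add_E _ c) => //; first exact: lt_Theta_word (S0 _ Dc).
    by apply: rank_ge_le (omul_zero E) _; apply: rank_ge_zero.
  have [c' [[Dc' cc'] rc']] := rc j.
  apply: (add_E _ (Theta 0 (apply_word x c'))); [exact: D0| |exact: IHb].
  apply: (@apply_word_mono 0 (0 :: x)) => //=; [|exact: S0|exact: S0].
  by apply: sub_all lx => k; apply: ltnW.
move=> Du uv ru; apply: rank_ge_oadd => k.
  exact: ((rank_geE _ _ _).1 (rank_ge_trans ru uv) k).
pose P e := exists w, tower_lt n w v /\ rank_ge (tower_lt n) (oadd d e) w.
have Pstep j w : tower_lt n w v -> exists y, [/\ block n 1 y,
    rank_ge (block_lt n 1) (@oelt (oadd (onat 1) (OSup f)) j) y &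
    tower_lt n (Theta 0 (apply_word y w)) v].
  move=> [Dw wv]; have [y [[By yx] ry]] := rx j; have [ly _ _] := By.
  exists y; split=> //; split; first exact: D0.
  by apply: Theta_word_lt => //; apply: S0.
apply: (@oexp_oexp_closed P _ k) => [e e' ee' [w [wv rw]]||e [w [wv rw]]|e j [w [wv rw]]].
- exists w; split=> //; apply: rank_ge_le rw.
  exact: oadd_mono (ole_refl d) ee'.
- exists u; split=> //; apply: rank_ge_le ru; exact: oadd_zero.
- have [y [By _ yv]] := Pstep (inl tt) w wv; have [ly _ _] := By.
  exists (Theta 0 (apply_word y w)); split=> //.
  apply: rank_ge_le (oadd_osucc _ _) _; case: wv => Dw _.
  by apply: rank_ge_succ rw; split=> //; apply: lt_Theta_word (S0 _ Dw).
- have [y [By ry yv]] := Pstep (inr j) w wv.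
  exists (Theta 0 (apply_word y w)); split=> //; case: wv => Dw _.
  apply: rank_ge_le (IHa j y _ _ By ry Dw rw).
  set F := oexp_omega _.
  apply: ole_trans (omul_mono (ole_refl F) (ole_oaddr _ _)).
  apply: ole_trans (omulDr_ge _ _ _).
  by apply: oadd_mono (ole_refl _); apply: ole_omulr; apply: oexp_pos.
Qed.

Lemma rank_ge_segment n a (u : segment (theta_tower n)) :
  rank_ge (tower_lt n) a (proj1_sig (proj1_sig u)) ->
  rank_ge (@segment_lt (theta_tower n)) a u.
Proof.
elim: a u => X f IH u ru i; have [y [[[Ty yt] yu] ry]] := ru i.
by exists (exist _ (exist _ y Ty) yt); split=> //; apply: IH.
Qed.

Theorem corollary3 (n : nat) (hn : (1 <= n)%N) :
  ole (omega_tower n.+2) (term_ord (theta_tower n)).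
Proof.
apply: oleI => k.
pose P c := exists u, below_tower n 0 u /\ rank_ge (tower_lt n) c u.
suff [u [[Tu ut] ru]] : P (oelt k).
  exists (exist _ (exist _ u Tu) ut).
  by apply: rank_ge_orank; apply: rank_ge_segment.
have block0 x : block n 1 x -> forall u, below_tower n 0 u ->
    below_tower n 0 (Theta 0 (apply_word x u)).
  by move=> Bx; have [_ _] := block_cons (leq0n n) Bx; apply.
apply: (@oexp_oexp_closed P _ k) => [c d cd [u [Du ru]]||c [u [Du ru]]|c j [u [Du ru]]].
- by exists u; split=> //; apply: rank_ge_le cd ru.
- by exists Zero; split; [split=> //; rewrite tower_Theta //; constructor|apply: rank_ge_zero].
- exists (Theta 0 u); split; first exact: (block0 [::]).
  apply: rank_ge_succ ru; split=> //.
  by apply: (@lt_Theta_word 0 [::]) => //; apply: Sraw_below Du.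
- have [//|x [Bx jx]] := @blocks_cofinal n n 1 _ j.
  have Bx1 : block n 1 (1 :: x).
    by apply: (@block_cat _ _ [:: 1]) => //; apply: block_cons.
  exists (Theta 0 (apply_word (1 :: x) u)); split; first exact: block0.
  apply: rank_ge_le (rank_ge_Theta Bx1 (rank_ge_cons hn Bx jx) Du ru).
  by apply: omul_mono (ole_refl _) (ole_oaddr _ _).
Qed.
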